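(* Consider the option market described in the context. Let $x=(q^{\mathrm{ask}},q^{\mathrm{bid}},u,\alpha)$ and consider the linear program of maximizing $-\tilde\pi_0(x)$ over the feasible polytope $\mathcal C$, where $\tilde\pi_0$, $\tilde\Pi$ and $\mathcal C$ are defined in the context. Let $x^*=(q^{\mathrm{ask}*},q^{\mathrm{bid}*},u^*,\alpha^* )$ be an optimal solution, and set $\tilde\Pi^*(s):=\tilde\Pi(x^*,s)$ and $\tilde\pi_0^*:=\tilde\pi_0(x^* )$. Exactly one of the following cases occurs: 1. (Strong-arbitrage case.) If $\tilde\pi_0^*<0$, then the optimizer must saturate at least one depth constraint, i.e. there exists $i\in\{1,\dots,N\}$ such that $q_i^{\mathrm{ask}*}=Q_i^{\mathrm{ask}}$ or $q_i^{\mathrm{bid}*}=Q_i^{\mathrm{bid}}$. Moreover, the implementation $(w,c)$ associated with $x^*$ yields a strong arbitrage. 2. (Weak-arbitrage case.) If $\tilde\pi_0^*=0$ and $\tilde\Pi^*$ is not identically zero, then the set of optimal solutions contains a non-trivial segment along the ray generated by $x^*$: every $\lambda x^*$ with $0\le\lambda\le\bar\lambda(x^* )$ is an optimal solution, where $\bar\lambda(x^* )$ is the maximal scaling factor compatible with the upper size bounds, i.e. $$\bar\lambda(x^* )=\min\Big\{\min_{i:\,q_i^{\mathrm{ask}*}>0}\frac{Q_i^{\mathrm{ask}}}{q_i^{\mathrm{ask}*}},\ \min_{i:\,q_i^{\mathrm{bid}*}>0}\frac{Q_i^{\mathrm{bid}}}{q_i^{\mathrm{bid}*}}\Big\}.$$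 The extremal point $\bar\lambda(x^* )x^*$ lies on the boundary of $\mathcal C$ and therefore saturates at least one depth constraint. In addition, the implementation $(w,c)$ associated with $x^*$ yields a weak arbitrage. 3. (No-arbitrage case.) The market is arbitrage-free if and only if $\tilde\Pi^*(s)=0$ for all $s\ge0$. In this case, the unique optimal solution is the null portfolio $x^*=0$. Here the implementation $(w,c)$ associated with $x^*$ is given by $w_{K_0}=u^*$, $w_{K_i}=q_i^{\mathrm{ask}*}-q_i^{\mathrm{bid}*}$ for $i=1,\dots,N$, and $c=-\pi_0(q^{\mathrm{ask}*},q^{\mathrm{bid}*},u^* )$.
   Context: Market: maturity $T>0$, constant risk-free rate $r$ and dividend yield $q$ (the scalar $q$ is unrelated to the vectors $q^{\mathrm{ask}},q^{\mathrm{bid}}\in\mathbb R^N$), spot $S_0>0$, strikes $0=K_0<K_1<\dots<K_N$, call quotes $C_i^{\mathrm{bid}}\le C_i^{\mathrm{ask}}$ with finite sizes $Q_i^{\mathrm{bid}},Q_i^{\mathrm{ask}}$ ($i=1,\dots,N$). The underlying (viewed as a call of strike $K_0=0$) trades frictionlessly at price $S_0e^{-qT}$, with zero bid-ask spread and no position limits, and its spot price is assumed consistent with the absence of static arbitrage relative to the option market. Notation: $x_+=x^+=\max(x,0)$, $x^-=\max(-x,0)$. Program: $$\pi_0(q^{\mathrm{ask}},q^{\mathrm{bid}},u)=\sum_{i=1}^N(q_i^{\mathrm{ask}}C_i^{\mathrm{ask}}-q_i^{\mathrm{bid}}C_i^{\mathrm{bid}})+uS_0e^{-qT},\qquad \tilde\pi_0(x)=\pi_0(q^{\mathrm{ask}},q^{\mathrm{bid}},u)-\alpha,$$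 $$\tilde\Pi(x,s)=\sum_{i=1}^N(q_i^{\mathrm{ask}}-q_i^{\mathrm{bid}})(s-K_i)_++us-\alpha e^{rT}.$$ $\mathcal C$ is the set of $x=(q^{\mathrm{ask}},q^{\mathrm{bid}},u,\alpha)\in\mathbb R^N\times\mathbb R^N\times\mathbb R\times\mathbb R$ with $\sum_{i=1}^{j}(q_i^{\mathrm{ask}}-q_i^{\mathrm{bid}})(K_j-K_i)+uK_j-\alpha e^{rT}\ge0$ for $j=1,\dots,N$; $\sum_{i=1}^N(q_i^{\mathrm{ask}}-q_i^{\mathrm{bid}})+u\ge0$; $\alpha\le0$; $0\le q_i^{\mathrm{ask}}\le Q_i^{\mathrm{ask}}$ and $0\le q_i^{\mathrm{bid}}\le Q_i^{\mathrm{bid}}$ for all $i$ (the depth constraints). Equivalently, the size bounds hold and $\tilde\Pi(x,s)\ge0$ for all $s\ge0$. Arbitrage: a static portfolio is $w=(w_{K_0},\dots,w_{K_N})\in\mathbb R^{N+1}$ with $-Q_i^{\mathrm{bid}}\le w_{K_i}\le Q_i^{\mathrm{ask}}$ for $i=1,\dots,N$. Its terminal payoff is $V_T(w)=\sum_{i=0}^Nw_{K_i}(S_T-K_i)_+$, where $S_T\ge0$ is the terminal price, and its time-0 value is $V_0(w)=w_{K_0}S_0e^{-qT}+\sum_{i=1}^N(w_{K_i}^+C_i^{\mathrm{ask}}-w_{K_i}^-C_i^{\mathrm{bid}})$. Given a probability space $(\Omega,\mathcal F,\mathbb P)$ on which $S_T$ is defined, a portfolio $w$ with a cash position $c\in\mathbb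 R$ generates a weak arbitrage (with respect to $\mathbb P$; the notion depends on $\mathbb P$) if $V_0(w)+c=0$, $\mathbb P(V_T(w)+ce^{rT}\ge0)=1$ and $\mathbb P(V_T(w)+ce^{rT}>0)>0$. It generates a strong arbitrage if $V_0(w)+c=0$ and $V_T(w)+ce^{rT}>0$ in every state. The market is arbitrage-free if for any probability measure $\mathbb P$ on $(\mathbb R_+,\mathcal B(\mathbb R_+))$ (regarded as the law of $S_T$) that is absolutely continuous with respect to Lebesgue measure, no weak arbitrage exists.
   Formalization: ''Arbitrage-free'' ranges only over a.c. laws charging every open interval of R_+ (otherwise no market qualifies); its criterion is zero payoff for every optimal solution (x*=0 may be optimal despite weak arbitrage); literal uniqueness x*=0 needs positive spreads, else null portfolio. *)

(* Defs.v *)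
(* MathComp-Analysis *)
From HB Require Import structures.
From mathcomp Require Import all_boot all_order all_algebra.
From mathcomp Require Import all_classical all_reals all_analysis.

Set Implicit Arguments.
Unset Strict Implicit.
Unset Printing Implicit Defensive.

Import Order.TTheory GRing.Theory Num.Theory.
Import numFieldNormedType.Exports.

Local Open Scope classical_set_scope.
Local Open Scope ring_scope.

(* Strikes are indexed by 'I_N.+1 with K ord0 = 0 standing for the underlying;
   the option i : 'I_N has strike K (lift ord0 i), i.e. the index is shifted
   by one with respect to the usual 1..N. *)
Record market (R : realType) (N : nat) := Market {
  maturity : R;
  rate : R;
  dividend : R;
  spot : R;
  strike : 'I_N.+1 -> R;
  call_bid : 'I_N -> R;
  call_ask : 'I_N -> R;
  size_bid : 'I_N -> R;
  size_ask : 'I_N -> R;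
  maturity_gt0 : 0 < maturity;
  spot_gt0 : 0 < spot;
  strike0 : strike ord0 = 0;
  strike_incr : forall i j : 'I_N.+1, (i < j)%N -> strike i < strike j;
  call_bid_le_ask : forall i, call_bid i <= call_ask i;
  size_bid_ge0 : forall i, 0 <= size_bid i;
  size_ask_ge0 : forall i, 0 <= size_ask i
}.

Section Market.
Context {R : realType} {N : nat} (m : market R N).

Definition option_strike (i : 'I_N) : R := strike m (lift ord0 i).

Definition growth : R := expR (rate m * maturity m).

Definition underlying_price : R :=
  spot m * expR (- (dividend m * maturity m)).

(* x = (q_ask, q_bid, u, alpha) *)
Definition program_var : Type := ('rV[R]_N * 'rV[R]_N * R * R)%type.

Definition q_ask (x : program_var) (i : 'I_N) : R := x.1.1.1 0 i.
Definition q_bid (x : program_var) (i : 'I_N) : R := x.1.1.2 0 i.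
Definition q_und (x : program_var) : R := x.1.2.
Definition alpha (x : program_var) : R := x.2.

Definition pi0 (x : program_var) : R :=
  \sum_(i < N) (q_ask x i * call_ask m i - q_bid x i * call_bid m i)
  + q_und x * underlying_price.

Definition pi0_tilde (x : program_var) : R := pi0 x - alpha x.

Definition Pi_tilde (x : program_var) (s : R) : R :=
  \sum_(i < N) (q_ask x i - q_bid x i) * Num.max (s - option_strike i) 0
  + q_und x * s - alpha x * growth.

Definition feasible : set program_var := [set x |
  [/\ forall j : 'I_N,
        0 <= \sum_(i < N | (i <= j)%N)
               (q_ask x i - q_bid x i) * (option_strike j - option_strike i)
             + q_und x * option_strike j - alpha x * growth,
      0 <= \sum_(i < N) (q_ask x i - q_bid x i) + q_und x,
      alpha x <= 0,
      forall i : 'I_N, 0 <= q_ask x i <= size_ask m i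
    & forall i : 'I_N, 0 <= q_bid x i <= size_bid m i]].

Definition optimal (x : program_var) : Prop :=
  feasible x /\ forall y, feasible y -> - pi0_tilde y <= - pi0_tilde x.

Definition saturates_depth (x : program_var) : Prop :=
  exists i : 'I_N, q_ask x i = size_ask m i \/ q_bid x i = size_bid m i.

(* A minimum over an empty index set is +oo. *)
Definition max_scaling (x : program_var) : \bar R :=
  Order.min
    (\big[Order.min/+oo%E]_(i < N | 0 < q_ask x i) (size_ask m i / q_ask x i)%:E)
    (\big[Order.min/+oo%E]_(i < N | 0 < q_bid x i) (size_bid m i / q_bid x i)%:E).

Definition static_portfolio (w : 'rV[R]_N.+1) : Prop :=
  forall i : 'I_N, - size_bid m i <= w 0 (lift ord0 i) <= size_ask m i.

Definition terminal_payoff (w : 'rV[R]_N.+1) (s : R) : R :=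
  \sum_(i < N.+1) w 0 i * Num.max (s - strike m i) 0.

Definition initial_value (w : 'rV[R]_N.+1) : R :=
  w 0 ord0 * underlying_price
  + \sum_(i < N) (Num.max (w 0 (lift ord0 i)) 0 * call_ask m i
                  - Num.max (- w 0 (lift ord0 i)) 0 * call_bid m i).

Definition impl_w (x : program_var) : 'rV[R]_N.+1 :=
  \row_(i < N.+1)
    (if unlift ord0 i is Some j then q_ask x j - q_bid x j else q_und x).

Definition impl_c (x : program_var) : R := - pi0 x.

Definition weak_arbitrage {d : measure_display} {Omega : measurableType d}
    (P : probability Omega R) (S : Omega -> R) (w : 'rV[R]_N.+1) (c : R) : Prop :=
  [/\ static_portfolio w,
      initial_value w + c = 0,
      P [set omega | 0 <= terminal_payoff w (S omega) + c * growth] = 1%E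
    & (0 < P [set omega | (0 < terminal_payoff w (S omega) + c * growth)%R])%E].

Definition strong_arbitrage (w : 'rV[R]_N.+1) (c : R) : Prop :=
  [/\ static_portfolio w,
      initial_value w + c = 0
    & forall s : R, 0 <= s -> 0 < terminal_payoff w s + c * growth].

(* Every nonempty open interval of R_+ is charged by the law of S. *)
Definition full_support {d : measure_display} {Omega : measurableType d}
    (P : probability Omega R) (S : Omega -> R) : Prop :=
  forall a b : R, 0 <= a -> a < b -> (0 < P (S @^-1` `]a, b[%classic))%E.

(* Probability measures on R_+ are represented as Borel probability measures
   on R that do not charge the negative half-line; S_T is then the identity.
   The full-support condition is needed: a law concentrated near 0 turns a
   short position in the underlying, which is not subject to any size limit,
   into a weak arbitrage, whatever the quotes. *)
Definition arbitrage_free : Prop :=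
  forall P : probability (measurableTypeR R) R,
    P `]-oo, 0[%classic = 0%E ->
    P `<< (@lebesgue_measure R) ->
    full_support P (fun s : R => s) ->
    ~ exists w c, weak_arbitrage P (fun s : R => s) w c.

End Market.

Definition boundary {T : topologicalType} (A : set T) : set T :=
  closure A `\` interior A.

Definition exactly_one (A B C : Prop) : Prop :=
  [/\ [\/ A, B | C], ~ (A /\ B), ~ (A /\ C) & ~ (B /\ C)].

(* Main.v *)
Require Import Defs.
From HB Require Import structures.
From mathcomp Require Import all_boot all_order all_algebra.
From mathcomp Require Import all_classical all_reals all_analysis.
From mathcomp Require Import measurable_realfun.
From mathcomp Require Import ring lra.

(* The program is positively homogeneous except for the upper size bounds, so
   an optimum of negative cost must be stopped by one of them, and an optimum of
   cost 0 can be rescaled until it hits one. The net payoff of the implementation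
   of an optimum x is Pi_tilde x - pi0_tilde x * growth, since an optimum never
   pays the bid-ask spread on both sides of the same quote; it is nonnegative on
   the half-line, and positive at some point unless Pi_tilde x vanishes there.
   Conversely a weak arbitrage for a law of full support is a feasible point of
   cost 0. As the kinks of Pi_tilde x sit at distinct strikes, its vanishing
   forces all net positions and the cash position to be 0. *)

Set Implicit Arguments.
Unset Strict Implicit.
Unset Printing Implicit Defensive.

Import Order.TTheory GRing.Theory Num.Theory.
Import numFieldNormedType.Exports.

Local Open Scope classical_set_scope.
Local Open Scope ring_scope.

(** * Payoffs of static portfolios as piecewise affine functions *)

Section Payoff.
Context {R : realType} {N : nat} (m : market R N).
Implicit Types (w : 'rV[R]_N.+1) (c s : R).

Lemma strike_le (i j : 'I_N.+1) : (i <= j)%N -> strike m i <= strike m j.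
Proof.
rewrite leq_eqVlt => /predU1P[/val_inj -> //|ij].
exact: ltW (strike_incr m ij).
Qed.

Lemma strike_ge0 (i : 'I_N.+1) : 0 <= strike m i.
Proof. by rewrite -(strike0 m) strike_le. Qed.

Lemma growth_gt0 : 0 < growth m.
Proof. exact: expR_gt0. Qed.

Lemma terminal_payoff0 w : terminal_payoff m w 0 = 0.
Proof.
apply: big1 => i _; rewrite max_r ?mulr0//.
by rewrite sub0r oppr_le0 strike_ge0.
Qed.

(** Past the last strike every call is in the money, so each position enters the slope in full. *)
Lemma terminal_payoff_beyond w t : 0 <= t ->
  terminal_payoff m w (strike m ord_max + t) =
  terminal_payoff m w (strike m ord_max) + (\sum_i w 0 i) * t.
Proof.
move=> t0; rewrite mulr_suml -big_split/=; apply: eq_bigr => i _.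
have iN : strike m i <= strike m ord_max by rewrite strike_le ?leq_ord.
rewrite !max_l ?subr_ge0//; last by rewrite (le_trans iN)// lerDl.
by rewrite -mulrDr addrAC.
Qed.

(* Between consecutive strikes the payoff is affine, beyond the last one its
   slope is the total position. *)
Lemma terminal_payoff_ge0 w c :
    (forall j, 0 <= terminal_payoff m w (strike m j) + c) ->
    0 <= \sum_i w 0 i ->
  forall s, 0 <= s -> 0 <= terminal_payoff m w s + c.
Proof.
move=> wK w0 s s0.
have P0 : (fun i => strike m i <= s) ord0 by rewrite strike0.
(* Take the last strike at or below [s]; the strike 0 of the underlying ensures that there is
   one. *)
case: (@arg_maxnP _ ord0 (fun i => strike m i <= s) val P0) => j js jmax.
have [jN|jN] := ltnP j N; last first.
  have jE : j = ord_max by apply/val_inj/anti_leq; rewrite leq_ord jN.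
  rewrite -(subrK (strike m ord_max) s) [s - _ + _]addrC.
  rewrite jE in js; rewrite terminal_payoff_beyond ?subr_ge0// addrAC.
  by rewrite addr_ge0// mulr_ge0 ?subr_ge0.
pose k : 'I_N.+1 := Ordinal (jN : j.+1 < N.+1)%N.
have sk : s < strike m k.
  by rewrite ltNge; apply/negP => /jmax /=; rewrite ltnn.
have jk : strike m j < strike m k by exact: strike_incr.
(* Interpolation between the two neighbouring strikes, multiplied by their gap to avoid a
   division. *)
suff : 0 <= (strike m k - strike m j) * (terminal_payoff m w s + c).
  by rewrite pmulr_rge0// subr_gt0.
suff -> : (strike m k - strike m j) * (terminal_payoff m w s + c) =
    (strike m k - s) * (terminal_payoff m w (strike m j) + c) +
    (s - strike m j) * (terminal_payoff m w (strike m k) + c).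
  by rewrite addr_ge0// mulr_ge0// subr_ge0// ltW.
suff : (strike m k - strike m j) * terminal_payoff m w s =
    (strike m k - s) * terminal_payoff m w (strike m j) +
    (s - strike m j) * terminal_payoff m w (strike m k).
  by move=> h; rewrite mulrDr h; ring.
rewrite !mulr_sumr -big_split/=; apply: eq_bigr => i _.
(* No strike lies strictly between the two, so each call is either in the money or out of the money
   on the whole interval, and is affine there. *)
have [ij|ji] := leqP i j.
  have {}ij := strike_le ij.
  rewrite !max_l ?subr_ge0//; [by ring|lra|lra].
have {}ji : strike m k <= strike m i by rewrite strike_le.
rewrite !max_r ?subr_le0//; [by ring|lra|lra].
Qed.

(** A negative final slope would drive the payoff below 0 far enough past the last strike. *)
Lemma total_position_ge0 w c :
  (forall s, 0 <= s -> 0 <= terminal_payoff m w s + c) -> 0 <= \sum_i w 0 i.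
Proof.
move=> wc; rewrite leNgt; apply/negP => w0.
set a := terminal_payoff m w (strike m ord_max) + c.
have a0 : 0 <= a by apply: wc; exact: strike_ge0.
set W := \sum_i w 0 i in w0.
(* At this distance past the last strike, the slope [W] has brought the net payoff from [a] down to
   -1. *)
have t0 : 0 <= (a + 1) / - W by apply: divr_ge0; lra.
have := wc (strike m ord_max + (a + 1) / - W) (addr_ge0 (strike_ge0 _) t0).
rewrite terminal_payoff_beyond// -/W addrAC -/a.
have -> : W * ((a + 1) / - W) = - (a + 1) by field; exact: ltr0_neq0.
lra.
Qed.

(* The coefficients are read off one strike after the other: the payoff just
   above a strike only involves the calls struck at or below it. *)
Lemma terminal_payoff_eq0 w :
  (forall s, 0 <= s -> terminal_payoff m w s = 0) -> w = 0.
Proof.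
move=> wE; apply/rowP => j; rewrite mxE.
have [n] := ubnP (j : nat); elim: n j => // n IH j; rewrite ltnS => jn.
(* The next strike serves as [s]; above the last strike any point does. *)
have [s [js sK]] : exists s, strike m j < s /\
    (forall i : 'I_N.+1, (j < i)%N -> s <= strike m i).
  have [jN|jN] := ltnP j N.
    exists (strike m (Ordinal (jN : j.+1 < N.+1)%N)); split.
      exact: strike_incr.
    by move=> i ji; exact: strike_le.
  exists (strike m j + 1); split; first by rewrite ltrDl.
  by move=> i ji; have := leq_ltn_trans jN ji; rewrite ltnNge leq_ord.
have := wE s (le_trans (strike_ge0 j) (ltW js)).
rewrite /terminal_payoff (bigD1 j)//= big1 ?addr0.
  rewrite max_l ?subr_ge0 ?ltW// => /eqP; rewrite mulf_eq0 subr_eq0.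
  by rewrite (gt_eqF js) orbF => /eqP.
move=> i; rewrite neq_ltn => /orP[ij|ji].
  by rewrite IH ?mul0r// (leq_trans ij).
by rewrite max_r ?mulr0// subr_le0 sK.
Qed.

Lemma continuous_terminal_payoff w : continuous (terminal_payoff m w).
Proof.
rewrite (_ : terminal_payoff m w =
    \sum_i (fun s => w 0 i * Num.max (s - strike m i) 0)); last first.
  by apply/funext => s; rewrite fct_sumE.
elim/big_ind: _ => [s|f g cf cg s|i _ s]; first exact: cst_continuous.
  exact: cvgD (cf s) (cg s).
apply: cvgM; first exact: cvg_cst.
apply: (@continuous_max R R (fun s => s - strike m i) (fun=> 0)).
  by apply: cvgB; [exact: cvg_id|exact: cvg_cst].
exact: cvg_cst.
Qed.

End Payoff.

(** * Feasibility, scaling and netting in the linear program *)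

Section Program.
Context {R : realType} {N : nat} (m : market R N).
Local Notation var := (program_var (R := R) (N := N)).
Implicit Types (x y : var) (i j : 'I_N).

Lemma impl_w_ord0 x : impl_w x 0 ord0 = q_und x.
Proof. by rewrite mxE unlift_none. Qed.

Lemma impl_w_lift x i : impl_w x 0 (lift ord0 i) = q_ask x i - q_bid x i.
Proof. by rewrite mxE liftK. Qed.

(** On the half-line the underlying is the call of strike 0. For negative [s] the sides may differ,
    since the term in [q_und x] is not truncated in [Pi_tilde]. *)
Lemma Pi_tildeE x s : 0 <= s ->
  Pi_tilde m x s = terminal_payoff m (impl_w x) s - alpha x * growth m.
Proof.
move=> s0; rewrite /Pi_tilde /terminal_payoff big_ord_recl impl_w_ord0.
rewrite strike0 subr0 max_l// [q_und x * s + _]addrC; congr (_ + _ - _).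
by apply: eq_bigr => i _; rewrite impl_w_lift.
Qed.

Lemma eq_Pi_tilde x y s : impl_w x = impl_w y -> alpha x = alpha y -> 0 <= s ->
  Pi_tilde m x s = Pi_tilde m y s.
Proof. by move=> xy axy s0; rewrite !Pi_tildeE// xy axy. Qed.

Lemma sum_impl_w x :
  \sum_i impl_w x 0 i = \sum_(i < N) (q_ask x i - q_bid x i) + q_und x.
Proof.
rewrite big_ord_recl impl_w_ord0 addrC; congr (_ + _).
by apply: eq_bigr => i _; rewrite impl_w_lift.
Qed.

Lemma Pi_tilde_strike x j :
  Pi_tilde m x (option_strike m j) =
  \sum_(i < N | (i <= j)%N)
     (q_ask x i - q_bid x i) * (option_strike m j - option_strike m i)
  + q_und x * option_strike m j - alpha x * growth m.
Proof.
congr (_ + _ - _); rewrite [RHS]big_mkcond; apply: eq_bigr => i _.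
case: leqP => ij; [rewrite max_l//|rewrite max_r ?mulr0//].
  by rewrite subr_ge0 strike_le// !lift0 ltnS.
by rewrite subr_le0 strike_le// !lift0 ltnS ltnW.
Qed.

(** The payoff is affine between strikes, so its sign is decided by its values at the strikes and
    its final slope; the constraint on [alpha] is the value at the strike 0. *)
Lemma feasibleP x : feasible m x <->
  [/\ forall s, 0 <= s -> 0 <= Pi_tilde m x s,
      forall i, 0 <= q_ask x i <= size_ask m i
    & forall i, 0 <= q_bid x i <= size_bid m i].
Proof.
split=> [[xK xW ax xa xb]|[xPi xa xb]]; split=> //.
- move=> s s0; rewrite Pi_tildeE//; apply: terminal_payoff_ge0 => // [j|].
    have [i ->|->] := unliftP ord0 j; last first.
      rewrite strike0 terminal_payoff0 add0r -mulNr mulr_ge0 ?oppr_ge0//.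
      exact/ltW/growth_gt0.
    by rewrite -Pi_tildeE ?strike_ge0// Pi_tilde_strike.
  by rewrite sum_impl_w.
- by move=> j; rewrite -Pi_tilde_strike xPi// strike_ge0.
- rewrite -sum_impl_w.
  apply: (@total_position_ge0 _ _ m _ (- (alpha x * growth m))).
  by move=> s s0; rewrite -Pi_tildeE// xPi.
- have := xPi 0 (lexx _); rewrite Pi_tildeE// terminal_payoff0 add0r oppr_ge0.
  by rewrite pmulr_lle0 ?growth_gt0.
Qed.

Lemma q_askZ k x i : q_ask (k *: x) i = k * q_ask x i.
Proof. by rewrite /q_ask mxE. Qed.

Lemma q_bidZ k x i : q_bid (k *: x) i = k * q_bid x i.
Proof. by rewrite /q_bid mxE. Qed.

Lemma Pi_tildeZ k x s : Pi_tilde m (k *: x) s = k * Pi_tilde m x s.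
Proof.
rewrite /Pi_tilde mulrBr mulrDr mulr_sumr !mulrA; congr (_ + _ - _).
by apply: eq_bigr => i _; rewrite q_askZ q_bidZ -mulrBr mulrA.
Qed.

Lemma pi0_tildeZ k x : pi0_tilde m (k *: x) = k * pi0_tilde m x.
Proof.
rewrite /pi0_tilde /pi0 mulrBr mulrDr mulr_sumr !mulrA; congr (_ + _ - _).
by apply: eq_bigr => i _; rewrite q_askZ q_bidZ -!mulrA -mulrBr.
Qed.

Lemma feasibleZ k x : 0 <= k -> feasible m x ->
    (forall i, k * q_ask x i <= size_ask m i) ->
    (forall i, k * q_bid x i <= size_bid m i) ->
  feasible m (k *: x).
Proof.
move=> k0 /feasibleP[xPi xa xb] ka kb; apply/feasibleP; split=> [s s0|i|i].
- by rewrite Pi_tildeZ mulr_ge0// xPi.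
- by rewrite q_askZ ka andbT mulr_ge0//; case/andP: (xa i).
- by rewrite q_bidZ kb andbT mulr_ge0//; case/andP: (xb i).
Qed.

Lemma feasibleZ_le1 k x : 0 <= k <= 1 -> feasible m x -> feasible m (k *: x).
Proof.
move=> /andP[k0 k1] xf; apply: feasibleZ => // i.
- have /feasibleP[_ /(_ i)/andP[q0 qs] _] := xf.
  by rewrite (le_trans _ qs)// ler_piMl.
- have /feasibleP[_ _ /(_ i)/andP[q0 qs]] := xf.
  by rewrite (le_trans _ qs)// ler_piMl.
Qed.

Lemma optimal_le x y : optimal m x -> feasible m y ->
  pi0_tilde m x <= pi0_tilde m y.
Proof. by move=> [_ xy] /xy; rewrite lerN2. Qed.

(** The null portfolio, obtained as [0 *: x], is feasible and costs nothing. *)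
Lemma optimal_le0 x : optimal m x -> pi0_tilde m x <= 0.
Proof.
move=> xo; rewrite -(mul0r (pi0_tilde m x)) -pi0_tildeZ.
by apply: optimal_le => //; apply: feasibleZ_le1 (xo.1); rewrite lexx ler01.
Qed.

Lemma optimal_eq0 x y : optimal m x -> pi0_tilde m x = 0 ->
  optimal m y <-> feasible m y /\ pi0_tilde m y = 0.
Proof.
move=> xo x0; split=> [yo|[yf y0]]; last first.
  by split=> // z zf; rewrite y0 -x0 lerN2; exact: optimal_le.
split; first exact: yo.1.
by apply/le_anti; rewrite optimal_le0//= -x0; exact: optimal_le yo.1.
Qed.

(* Buying and selling the same call only costs the bid-ask spread. *)
Lemma optimal_netting x : optimal m x -> forall i,
  Num.min (q_ask x i) (q_bid x i) * (call_ask m i - call_bid m i) = 0.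
Proof.
move=> xo.
(* [c i] is the amount both bought and sold; [y] cancels it, which keeps the payoff and saves [c i]
   times the spread. *)
pose c i := Num.min (q_ask x i) (q_bid x i).
pose y : var := (\row_i (q_ask x i - c i), \row_i (q_bid x i - c i),
                 q_und x, alpha x).
have ya i : q_ask y i = q_ask x i - c i by rewrite /q_ask mxE.
have yb i : q_bid y i = q_bid x i - c i by rewrite /q_bid mxE.
have /feasibleP[xPi xa xb] := xo.1.
have c0 i : 0 <= c i.
  by rewrite /c le_min; case/andP: (xa i) => ->; case/andP: (xb i) => ->.
have yf : feasible m y.
  apply/feasibleP; split=> [s s0|i|i].
  - rewrite (@eq_Pi_tilde y x)//; first exact: xPi.
    apply/rowP => j; have [i ->|->] := unliftP ord0 j.
      by rewrite !impl_w_lift ya yb; ring.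
    by rewrite !impl_w_ord0.
  - rewrite ya subr_ge0 ge_min lexx/=.
    by case/andP: (xa i) => _; apply: le_trans; rewrite gerBl.
  - rewrite yb subr_ge0 ge_min lexx orbT/=.
    by case/andP: (xb i) => _; apply: le_trans; rewrite gerBl.
have yE : pi0_tilde m y =
    pi0_tilde m x - \sum_i c i * (call_ask m i - call_bid m i).
  rewrite /pi0_tilde /pi0 (eq_bigr (fun i =>
      (q_ask x i * call_ask m i - q_bid x i * call_bid m i) -
      c i * (call_ask m i - call_bid m i))) ?sumrB; first by ring.
  by move=> i _; rewrite ya yb; ring.
have t0 i : true -> 0 <= c i * (call_ask m i - call_bid m i).
  by rewrite mulr_ge0// subr_ge0 call_bid_le_ask.
(* The savings are nonnegative and optimality makes their sum nonpositive, so each of them is 0. *)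
move=> i; apply: (psumr_eq0P t0) => //; apply/le_anti.
rewrite sumr_ge0// andbT.
by have := optimal_le xo yf; rewrite yE; lra.
Qed.

(** [initial_value] prices net positions and [pi0] prices both sides. They differ by the spread on
    the amount both bought and sold, which is 0 by [optimal_netting]. *)
Lemma initial_value_impl_w x :
  optimal m x -> initial_value m (impl_w x) = pi0 m x.
Proof.
move=> /optimal_netting xc; rewrite /initial_value /pi0 addrC impl_w_ord0.
congr (_ + _); apply: eq_bigr => i _; rewrite impl_w_lift.
have := xc i; case: (leP (q_ask x i)) => ab xi.
  by rewrite max_r ?max_l; lra.
by rewrite max_l ?max_r; lra.
Qed.

Lemma static_portfolio_impl_w x : feasible m x -> static_portfolio m (impl_w x).
Proof.
move=> /feasibleP[_ xa xb] i; rewrite impl_w_lift.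
by have := xa i; have := xb i; lra.
Qed.

(** The implementation holds the cash [- pi0] where the program holds [- alpha]; the difference
    earns interest up to maturity. *)
Lemma impl_payoffE x s : 0 <= s ->
  terminal_payoff m (impl_w x) s + impl_c m x * growth m =
  Pi_tilde m x s - pi0_tilde m x * growth m.
Proof. by move=> s0; rewrite Pi_tildeE// /impl_c /pi0_tilde; ring. Qed.

Lemma impl_payoff_ge0 x s : optimal m x -> 0 <= s ->
  0 <= terminal_payoff m (impl_w x) s + impl_c m x * growth m.
Proof.
move=> xo s0; rewrite impl_payoffE//; have /feasibleP[xPi _ _] := xo.1.
have x0 := optimal_le0 xo.
by rewrite -mulNr addr_ge0 ?xPi// mulr_ge0 ?oppr_ge0// ltW// growth_gt0.
Qed.

Lemma impl_strong_arbitrage x : optimal m x -> pi0_tilde m x < 0 ->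
  strong_arbitrage m (impl_w x) (impl_c m x).
Proof.
move=> xo x0; split; first exact: static_portfolio_impl_w xo.1.
  by rewrite initial_value_impl_w// subrr.
move=> s s0; rewrite impl_payoffE//; have /feasibleP[xPi _ _] := xo.1.
by rewrite -mulNr ltr_wpDl ?xPi// mulr_gt0 ?oppr_gt0 ?growth_gt0.
Qed.

(** With slack in every bound, [k *: x] would remain feasible for some [k] above 1, and scaling up a
    negative cost lowers it. *)
Lemma optimal_saturates x : optimal m x -> pi0_tilde m x < 0 ->
  saturates_depth m x.
Proof.
move=> xo x0; apply: contrapT => xs.
have /feasibleP[_ xa xb] := xo.1.
have near_scaling q (b : R) : q < b -> \forall k \near (1 : R)^'+, k * q <= b.
  move=> qb; have kq : k * q @[k --> (1 : R)^'+] --> 1 * q.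
    by apply/cvg_at_right_filter; apply: cvgM; [exact: cvg_id|exact: cvg_cst].
  rewrite mul1r in kq; near=> k; apply: ltW; near: k; exact: cvgr_lt kq _ qb.
have : \forall k \near (1 : R)^'+, forall i,
    k * q_ask x i <= size_ask m i /\ k * q_bid x i <= size_bid m i.
  (* There are finitely many quotes, so one range of [k] suits them all. *)
  apply: filter_forall => i; apply: filterI; apply: near_scaling.
  - have /andP[_] := xa i; rewrite le_eqVlt => /predU1P[e|//].
    by exfalso; apply: xs; exists i; left.
  - have /andP[_] := xb i; rewrite le_eqVlt => /predU1P[e|//].
    by exfalso; apply: xs; exists i; right.
move=> /(filterI (nbhs_right_gt (1 : R)))/filter_ex[k [/= k1 kx]].
have kf : feasible m (k *: x).
  apply: feasibleZ xo.1 _ _ => [|i|i]; first by rewrite ltW// (lt_trans ltr01).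
    exact: (kx i).1.
  exact: (kx i).2.
by have := optimal_le xo kf; rewrite pi0_tildeZ; nra.
Unshelve. all: by end_near. Qed.

(** No call pays at 0, so the value there isolates [alpha]; the positions then follow from
    [terminal_payoff_eq0]. *)
Lemma Pi_tilde_eq0 x : (forall s, 0 <= s -> Pi_tilde m x s = 0) ->
  impl_w x = 0 /\ alpha x = 0.
Proof.
move=> xPi; have a0 : alpha x = 0.
  have := xPi 0 (lexx _); rewrite Pi_tildeE// terminal_payoff0 add0r => /eqP.
  by rewrite oppr_eq0 mulf_eq0 (gt_eqF (growth_gt0 m)) orbF => /eqP.
split=> //; apply: (@terminal_payoff_eq0 _ _ m) => s s0.
by have := xPi s s0; rewrite Pi_tildeE// a0 mul0r subr0.
Qed.

(** When all net positions vanish, equal amounts are bought and sold, and only the spreads are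
    paid. *)
Lemma pi0_impl_w_eq0 x : impl_w x = 0 ->
  pi0 m x = \sum_i q_ask x i * (call_ask m i - call_bid m i).
Proof.
move=> w0; rewrite /pi0 -impl_w_ord0 w0 mxE mul0r addr0.
apply: eq_bigr => i _.
by have := impl_w_lift x i; rewrite w0 mxE => /esym/subr0_eq <-; ring.
Qed.

Lemma pi0_tilde_ge0 x : feasible m x ->
  (forall s, 0 <= s -> Pi_tilde m x s = 0) -> 0 <= pi0_tilde m x.
Proof.
move=> /feasibleP[_ xa _] /Pi_tilde_eq0[w0 a0].
rewrite /pi0_tilde a0 subr0 pi0_impl_w_eq0// sumr_ge0// => i _.
by rewrite mulr_ge0 ?subr_ge0 ?call_bid_le_ask//; case/andP: (xa i).
Qed.

(** The cost is a sum of spreads paid, and it is 0. Where bid and ask agree, a quote may still be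
    bought and sold in equal amounts for free, hence the strict inequality. *)
Lemma trivial_optimal x : optimal m x ->
    (forall s, 0 <= s -> Pi_tilde m x s = 0) ->
  [/\ impl_w x = 0, impl_c m x = 0 /\ alpha x = 0
    & forall i, call_bid m i < call_ask m i -> q_ask x i = 0 /\ q_bid x i = 0].
Proof.
move=> xo xPi; have [w0 a0] := Pi_tilde_eq0 xPi.
have /feasibleP[_ xa _] := xo.1.
have p0 : pi0 m x = 0.
  apply/le_anti; have := pi0_tilde_ge0 xo.1 xPi; have := optimal_le0 xo.
  by rewrite /pi0_tilde a0 subr0 => -> ->.
split=> // [|i ci]; first by rewrite /impl_c p0 oppr0.
have t0 j : true -> 0 <= q_ask x j * (call_ask m j - call_bid m j).
  by rewrite mulr_ge0 ?subr_ge0 ?call_bid_le_ask//; case/andP: (xa j).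
have qa0 : q_ask x i = 0.
  have := psumr_eq0P t0; rewrite -pi0_impl_w_eq0// => /(_ p0 i isT)/eqP.
  by rewrite mulf_eq0 subr_eq0 (gt_eqF ci) orbF => /eqP.
split=> //; have := impl_w_lift x i.
by rewrite w0 mxE qa0 sub0r => /esym/eqP; rewrite oppr_eq0 => /eqP.
Qed.

(** Without options, feasibility gives [q_und x >= 0] and [alpha x <= 0]; a cost of 0 then forces
    both to vanish, as the underlying has a positive price. This makes [max_scaling] finite. *)
Lemma exists_quote x : feasible m x -> pi0_tilde m x = 0 ->
  (exists2 s, 0 <= s & Pi_tilde m x s <> 0) ->
  exists i, 0 < q_ask x i \/ 0 < q_bid x i.
Proof.
move=> xf x0 [s s0 xs]; apply: contrapT => xq; apply: xs.
have /feasibleP[_ xa xb] := xf.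
have qa0 i : q_ask x i = 0.
  have /andP[] := xa i; rewrite le_eqVlt => /predU1P[//|q0 _].
  by exfalso; apply: xq; exists i; left.
have qb0 i : q_bid x i = 0.
  have /andP[] := xb i; rewrite le_eqVlt => /predU1P[//|q0 _].
  by exfalso; apply: xq; exists i; right.
have [_ u0 a0 _ _] := xf.
rewrite big1 ?add0r in u0; last by move=> i _; rewrite qa0 qb0 subrr.
have S0 : 0 < underlying_price m by rewrite mulr_gt0 ?spot_gt0 ?expR_gt0.
move: x0; rewrite /pi0_tilde /pi0 big1 ?add0r; last first.
  by move=> i _; rewrite qa0 qb0 !mul0r subrr.
move=> x0; have a00 : alpha x = 0 by nra.
have u00 : q_und x = 0.
  by move/eqP: x0; rewrite a00 subr0 mulf_eq0 (gt_eqF S0) orbF => /eqP.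
rewrite /Pi_tilde a00 u00 !mul0r subr0 addr0 big1// => i _.
by rewrite qa0 qb0 subrr mul0r.
Qed.

(** A minimum over a nonempty finite family is attained, and the attaining quote is the one that the
    scaling saturates. *)
Lemma max_scalingP x : feasible m x ->
    (exists i, 0 < q_ask x i \/ 0 < q_bid x i) ->
  exists l, [/\ max_scaling m x = l%:E, 1 <= l,
    forall i, l * q_ask x i <= size_ask m i,
    forall i, l * q_bid x i <= size_bid m i
  & exists i, 0 < q_ask x i /\ l * q_ask x i = size_ask m i \/
              0 < q_bid x i /\ l * q_bid x i = size_bid m i].
Proof.
move=> /feasibleP[_ xa xb] xq.
have [i Mi] : exists i,
    0 < q_ask x i /\ max_scaling m x = (size_ask m i / q_ask x i)%:E \/
    0 < q_bid x i /\ max_scaling m x = (size_bid m i / q_bid x i)%:E.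
  (* Each of the two minima is either [+oo], over an empty family, or attained. *)
  have bigminP (q z : 'I_N -> R) :
      \big[Order.min/+oo%E]_(i < N | 0 < q i) (z i / q i)%:E = +oo%E /\
        ~ (exists i, 0 < q i) \/
      exists2 i, 0 < q i &
        \big[Order.min/+oo%E]_(i < N | 0 < q i) (z i / q i)%:E = (z i / q i)%:E.
    have [[j qj]|qN] := pselect (exists j, 0 < q j); last first.
      left; split=> //; apply: big_pred0 => i.
      by apply/negP => qi; apply: qN; exists i.
    right; rewrite (bigmin_eq_arg _ j)// => [|i _]; last exact: leey.
    by case: arg_minP => // i qi _; exists i.
  rewrite /max_scaling.
  have [[-> qaN]|[j qj ->]] := bigminP (q_ask x) (size_ask m); last first.
    have [[-> _]|[k qk ->]] := bigminP (q_bid x) (size_bid m).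
      by exists j; left; rewrite min_l// leey.
    rewrite /Order.min; case: ifP => _; [exists j; left|exists k; right] => //.
  have [[_ qbN]|[k qk ->]] := bigminP (q_bid x) (size_bid m).
    case: xq => i [qi|qi]; [case: qaN|case: qbN]; by exists i.
  by exists k; right; rewrite min_r// leey.
have Ml : exists2 l, max_scaling m x = l%:E &
    exists i, 0 < q_ask x i /\ l * q_ask x i = size_ask m i \/
              0 < q_bid x i /\ l * q_bid x i = size_bid m i.
  case: Mi => -[qi Mi]; [exists (size_ask m i / q_ask x i)|
    exists (size_bid m i / q_bid x i)] => //; exists i; [left|right];
    by split=> //; rewrite divfK// gt_eqF.
have [l lM li] := Ml; exists l; split=> // [|j|j].
(* At the attaining quote, [l] times the amount is the full size, which is at least the amount. *)
- have [k [[qk lk]|[qk lk]]] := li.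
    by rewrite -(ler_pM2r qk) lk mul1r; case/andP: (xa k).
  by rewrite -(ler_pM2r qk) lk mul1r; case/andP: (xb k).
- have /andP[] := xa j; rewrite le_eqVlt => /predU1P[<- _|qj _].
    by rewrite mulr0 size_ask_ge0.
  rewrite -ler_pdivlMr// -lee_fin -lM ge_min; apply/orP; left.
  exact: bigmin_le_cond.
- have /andP[] := xb j; rewrite le_eqVlt => /predU1P[<- _|qj _].
    by rewrite mulr0 size_bid_ge0.
  rewrite -ler_pdivlMr// -lee_fin -lM ge_min; apply/orP; right.
  exact: bigmin_le_cond.
Qed.

(** From an interior point one could scale slightly up and stay feasible, but this pushes a positive
    saturated amount past its bound. *)
Lemma saturated_boundary x : feasible m x ->
    (exists i, 0 < q_ask x i /\ q_ask x i = size_ask m i \/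
               0 < q_bid x i /\ q_bid x i = size_bid m i) ->
  boundary (feasible m) x.
Proof.
move=> xf [i xi]; split; first exact: subset_closure.
move=> xint.
have xk : \forall k \near (1 : R)^'+, feasible m (k *: x).
  apply: cvg_within; have := @scalel_continuous R _ x 1.
  by rewrite /continuous_at scale1r; apply.
have [k [/= k1]] := filter_ex (filterI (nbhs_right_gt (1 : R)) xk).
move=> /feasibleP[_ /(_ i) ka /(_ i) kb].
move: ka kb; rewrite q_askZ q_bidZ => /andP[_ ka] /andP[_ kb].
by case: xi => -[q0 qE]; nra.
Qed.

End Program.

(** * Continuous payoffs and laws of full support *)

Section Probability.
Context {R : realType}.

Lemma measurable_preimage_itv d (Omega : measurableType d) (S : Omega -> R)
    (f : R -> R) (i : interval R) :
  measurable_fun setT S -> continuous f ->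
  measurable ((f \o S) @^-1` [set` i]).
Proof.
move=> mS cf; rewrite -[X in measurable X]setTI.
by apply: (measurableT_comp (continuous_measurable_fun cf) mS).
Qed.

(** Positivity at [s0] extends by continuity to an interval on its right. That side stays in the
    half-line even at [s0 = 0], so the law charges it. *)
Lemma full_support_gt0 d (Omega : measurableType d) (P : probability Omega R)
    (S : Omega -> R) (f : R -> R) s0 :
    measurable_fun setT S -> full_support P S -> continuous f ->
    0 <= s0 -> 0 < f s0 ->
  (0 < P [set omega | (0 < f (S omega))%R])%E.
Proof.
move=> mS PS cf s00 fs0.
have : \forall s \near s0^'+, 0 < f s.
  by apply: cvg_within; exact: (cvgr_gt (f s0) (cf s0)).
move=> [e /= e0 fe].
apply: lt_le_trans (PS s0 (s0 + e) s00 _) _; first by rewrite ltrDl.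
apply: le_measure; rewrite ?inE.
- by rewrite -[X in measurable X]setTI; apply: mS => //; exact: measurable_itv.
- rewrite (_ : [set _ | _] = (f \o S) @^-1` `]0, +oo[%classic); last first.
    by apply/seteqP; split=> o /=; rewrite in_itv/= andbT.
  exact: measurable_preimage_itv.
- move=> o /=; rewrite in_itv/= => /andP[sS Se]; apply: fe => //=.
  by rewrite ltr_norml; lra.
Qed.

(** The exponential law of rate 1 is one; it is the law against which [arbitrage_free] gets
    tested. *)
Lemma exists_full_support_law :
  exists P : probability (measurableTypeR R) R,
    [/\ P `]-oo, 0[%classic = 0%E, P `<< (@lebesgue_measure R)
      & full_support P (fun s : R => s)].
Proof.
pose P : probability (measurableTypeR R) R :=
  exponential_distribution_exponential_prob__canonical__probability_measure_Probability
    (@ltr01 R).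
have PE A : P A = exponential_prob 1 A by [].
exists P; split.
- rewrite PE /exponential_prob integral0_eq// => x; rewrite /= in_itv/= => x0.
  by rewrite lt0_exponential_pdf.
- apply/null_content_dominatesP => A mA A0.
  rewrite PE; apply: null_set_integral => //.
  apply: (measurable_funS measurableT) => //; apply/measurable_EFinP.
  exact: measurable_exponential_pdf.
move=> a b a0 ab.
(* These points cut []a, b[] into thirds. Both are positive even if [a] is 0, and the mass of []a,
   b[] is at least the difference of the explicit masses of [[0, b']] and [[0, a']]. *)
pose a' := (2 * a + b) / 3; pose b' := (a + 2 * b) / 3.
have a'0 : 0 < a' by rewrite /a'; lra.
have b'0 : 0 < b' by rewrite /b'; lra.
have : (P `[0%R, b']%classic <= P `[0%R, a']%classic + P `]a, b[%classic)%E.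
  apply: (le_trans _ (measureU2 _ _ _)) => //.
  apply: le_measure; rewrite ?inE//; first exact: measurableU.
  move=> x /=; rewrite !in_itv/= => /andP[x0 xb'].
  have [xa'|xa'] := leP x a'; first by left; rewrite x0.
  by right; apply/andP; move: xb' xa'; rewrite /a' /b'; split; lra.
rewrite [P `[0, b']%classic]exponential_prob_itv0c//.
rewrite [P `[0, a']%classic]exponential_prob_itv0c// -leeBlDl//.
apply: lt_le_trans; rewrite -!EFinB lte_fin subr_gt0 ltrD2l ltrN2 ltr_expR.
by rewrite /a' /b'; lra.
Qed.

End Probability.

(** * From optimal solutions to arbitrages and back *)

Section Arbitrage.
Context {R : realType} {N : nat} (m : market R N).
Local Notation var := (program_var (R := R) (N := N)).
Implicit Types (x y : var) (w : 'rV[R]_N.+1) (c : R).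

Lemma continuous_net_payoff w c :
  continuous (fun s => terminal_payoff m w s + c).
Proof.
move=> s; apply: cvgD; last exact: cvg_cst.
exact: continuous_terminal_payoff.
Qed.

(** At an optimum the net payoff is nonnegative at every point of the half-line, so only the charge
    on its positivity depends on the law. Asking for a null negative half-line covers both laws on
    the line and nonnegative random prices. *)
Lemma impl_weak_arbitrage x d (Omega : measurableType d)
    (P : probability Omega R) (S : Omega -> R) :
    optimal m x -> measurable_fun setT S ->
    P (S @^-1` `]-oo, 0[%classic) = 0%E ->
    (0 < P [set o | (0 < terminal_payoff m (impl_w x) (S o) +
                         impl_c m x * growth m)%R])%E ->
  weak_arbitrage m P S (impl_w x) (impl_c m x).
Proof.
move=> xo mS PS Pgt0; split=> //; first exact: static_portfolio_impl_w xo.1.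
  by rewrite initial_value_impl_w// subrr.
set f := fun s => terminal_payoff m (impl_w x) s + impl_c m x * growth m.
have mA : measurable [set o | 0 <= f (S o)].
  rewrite (_ : [set _ | _] = (f \o S) @^-1` `[0, +oo[%classic); last first.
    by apply/seteqP; split=> o /=; rewrite in_itv/= andbT.
  by apply: measurable_preimage_itv => //; exact: continuous_net_payoff.
have mneg : measurable (S @^-1` `]-oo, 0[%classic).
  by rewrite -[X in measurable X]setTI; apply: mS => //; exact: measurable_itv.
have : P (~` [set o | 0 <= f (S o)]) = 0%E.
  apply: (subset_measure0 _ mneg _ PS); first exact: measurableC.
  move=> o /= fo; rewrite in_itv/= ltNge; apply/negP => So.
  by apply: fo; exact: impl_payoff_ge0.
rewrite probability_setC// => /eqP; rewrite sube_eq ?add0e => [/eqP <-//| |].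
  by [].
by [].
Qed.

(** A negative value would persist on an interval, which full support charges. *)
Lemma net_payoff_ge0 d (Omega : measurableType d) (P : probability Omega R)
    (S : Omega -> R) w c :
    measurable_fun setT S -> full_support P S ->
    P [set o | 0 <= terminal_payoff m w (S o) + c] = 1%E ->
  forall s, 0 <= s -> 0 <= terminal_payoff m w s + c.
Proof.
move=> mS PS P1 s s0; rewrite leNgt; apply/negP => fs.
pose f := fun s => - (terminal_payoff m w s + c).
have cf : continuous f by move=> t; apply: cvgN; exact: continuous_net_payoff.
have fs0 : 0 < f s by rewrite oppr_gt0.
have := full_support_gt0 mS PS cf s0 fs0.
rewrite (_ : [set _ | _] =
    ~` [set o | 0 <= terminal_payoff m w (S o) + c]); last first.
  by apply/seteqP; split=> o /=; rewrite oppr_gt0 ltNge => /negP.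
rewrite probability_setC ?P1 ?subee ?ltxx//.
rewrite (_ : [set _ | _] = (f \o S) @^-1` `]-oo, 0]%classic); last first.
  by apply/seteqP; split=> o /=; rewrite in_itv/= oppr_le0.
exact: measurable_preimage_itv.
Qed.

(** Where [Pi_tilde] is positive so is the net payoff, the cost being nonpositive; the
    implementation would then be a weak arbitrage for the law of [exists_full_support_law]. *)
Lemma arbitrage_free_trivial x : arbitrage_free m -> optimal m x ->
  forall s, 0 <= s -> Pi_tilde m x s = 0.
Proof.
move=> af xo s s0; apply: contrapT => xs.
have /feasibleP[xPi _ _] := xo.1.
have [P [P0 Pleb PS]] := @exists_full_support_law R.
apply: (af P P0 Pleb PS); exists (impl_w x), (impl_c m x).
apply: impl_weak_arbitrage => //.
apply: (full_support_gt0 (f := fun s => terminal_payoff m (impl_w x) s +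
    impl_c m x * growth m) (s0 := s)) => //.
- exact: continuous_net_payoff.
- rewrite impl_payoffE// -mulNr ltr_pwDl//.
    by rewrite lt_def xPi// andbT; apply/eqP.
  by rewrite mulr_ge0 ?(ltW (growth_gt0 m))// oppr_ge0 optimal_le0.
Qed.

(** A section of [impl_w]: positive parts are bought, negative parts sold, and [- alpha] is the
    cash, so the objective is the initial value plus the cash. *)
Definition portfolio_var w c : var :=
  (\row_i Num.max (w 0 (lift ord0 i)) 0,
   \row_i Num.max (- w 0 (lift ord0 i)) 0, w 0 ord0, - c).

Lemma impl_portfolio_var w c : impl_w (portfolio_var w c) = w.
Proof.
apply/rowP => j; have [i ->|->] := unliftP ord0 j; last by rewrite impl_w_ord0.
rewrite impl_w_lift /q_ask /q_bid !mxE.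
by case: (leP 0 (w 0 (lift ord0 i))) => w0; [rewrite max_r|rewrite max_l]; lra.
Qed.

Lemma pi0_tilde_portfolio_var w c :
  pi0_tilde m (portfolio_var w c) = initial_value m w + c.
Proof.
rewrite /pi0_tilde opprK /pi0 /initial_value addrC [RHS]addrC; congr (_ + _).
rewrite addrC; congr (_ + _); apply: eq_bigr => i _.
by rewrite /q_ask /q_bid !mxE.
Qed.

Lemma feasible_portfolio_var w c : static_portfolio m w ->
    (forall s, 0 <= s -> 0 <= terminal_payoff m w s + c * growth m) ->
  feasible m (portfolio_var w c).
Proof.
move=> wS ws; apply/feasibleP; split=> [s s0|i|i].
- by rewrite Pi_tildeE// impl_portfolio_var mulNr opprK ws.
- rewrite /q_ask mxE le_max lexx orbT/= ge_max size_ask_ge0 andbT.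
  by case/andP: (wS i).
- rewrite /q_bid mxE le_max lexx orbT/= ge_max size_bid_ge0 andbT.
  by case/andP: (wS i); rewrite lerNl.
Qed.

(* Under full support the net payoff of a weak arbitrage is nonnegative on the
   whole half-line, so the arbitrage is itself a feasible point of value 0,
   hence an optimal one. *)
Lemma arbitrage_freeP x : optimal m x ->
  arbitrage_free m <->
  (forall y, optimal m y -> forall s, 0 <= s -> Pi_tilde m y s = 0).
Proof.
move=> xo; split=> [af y yo|opt0]; first exact: arbitrage_free_trivial.
move=> P P0 _ PS [w [c [wS w0 Pge0 Pgt0]]].
have x0 : pi0_tilde m x = 0.
  by apply/le_anti; rewrite optimal_le0// (pi0_tilde_ge0 xo.1)//; exact: opt0.
have mid : @measurable_fun _ _ (measurableTypeR R) R setT (fun s : R => s).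
  by [].
have ws := net_payoff_ge0 mid PS Pge0.
have yo : optimal m (portfolio_var w c).
  apply/(optimal_eq0 _ xo x0); split; first exact: feasible_portfolio_var.
  by rewrite pi0_tilde_portfolio_var.
(* The net payoff of this optimum vanishes on the half-line, so it can be positive only at negative
   prices, which have mass 0. *)
move: Pgt0; rewrite lt_neqAle => /andP[/eqP + _]; apply.
apply/esym; apply: (subset_measure0 _ _ _ P0) => //.
  rewrite (_ : [set _ | _] =
      ((fun s => terminal_payoff m w s + c * growth m) \o id) @^-1`
      `]0, +oo[%classic); last first.
    by apply/seteqP; split=> o /=; rewrite in_itv/= andbT.
  apply: (measurable_preimage_itv _ mid).
  exact: continuous_net_payoff.
move=> s /=; rewrite in_itv/= => fs; rewrite ltNge; apply/negP => s0.
have := opt0 _ yo s s0.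
rewrite Pi_tildeE// impl_portfolio_var mulNr opprK => f0.
by rewrite f0 ltxx in fs.
Qed.

(** A cost of 0 stays 0 along the ray, so feasibility alone decides optimality, and only the upper
    size bounds end the segment. *)
Lemma optimal_segment x : optimal m x -> pi0_tilde m x = 0 ->
    (exists2 s, 0 <= s & Pi_tilde m x s <> 0) ->
  exists l : R,
    [/\ max_scaling m x = l%:E,
        0 < l,
        forall lam : R, 0 <= lam <= l -> optimal m (lam *: x),
        boundary (feasible m) (l *: x)
      & saturates_depth m (l *: x)].
Proof.
move=> xo x0 xs; have xf := xo.1.
have [l [lM l1 la lb [i li]]] := max_scalingP xf (exists_quote xf x0 xs).
have l0 : 0 < l := lt_le_trans ltr01 l1.
exists l; split=> //.
- move=> k /andP[k0 kl]; apply/(optimal_eq0 _ xo x0).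
  rewrite pi0_tildeZ x0 mulr0; split=> //.
  have /feasibleP[_ xa xb] := xf.
  apply: feasibleZ => // j.
    by apply: le_trans (la j); rewrite ler_wpM2r//; case/andP: (xa j).
  by apply: le_trans (lb j); rewrite ler_wpM2r//; case/andP: (xb j).
- apply: saturated_boundary; first by apply: feasibleZ => //; exact: ltW.
  exists i; rewrite q_askZ q_bidZ.
  by case: li => -[q0 lq]; [left|right]; split=> //; exact: mulr_gt0.
- by exists i; rewrite q_askZ q_bidZ; case: li => -[_ ->]; [left|right].
Qed.

End Arbitrage.

(** The trichotomy comes in two forms: when the optimal value is 0 the null portfolio is optimal
    too, so one optimum with vanishing payoff does not exclude arbitrage, while all of them together
    do. Uniqueness is claimed under positive spreads, given the free round trips at equal bid and
    ask. *)
Theorem proposition16 (R : realType) (N : nat) (m : market R N)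
    (x : program_var (R := R) (N := N)) (hx : optimal m x) :
  [/\ exactly_one
        (pi0_tilde m x < 0)
        (pi0_tilde m x = 0 /\ exists2 s : R, 0 <= s & Pi_tilde m x s <> 0)
        (forall s : R, 0 <= s -> Pi_tilde m x s = 0),
      exactly_one
        (pi0_tilde m x < 0)
        (pi0_tilde m x = 0 /\
         exists2 y, optimal m y & exists2 s : R, 0 <= s & Pi_tilde m y s <> 0)
        (arbitrage_free m),
      pi0_tilde m x < 0 ->
        saturates_depth m x /\ strong_arbitrage m (impl_w x) (impl_c m x),
      (pi0_tilde m x = 0 /\ exists2 s : R, 0 <= s & Pi_tilde m x s <> 0) ->
        [/\ x <> 0,
            exists l : R,
              [/\ max_scaling m x = l%:E,
                  0 < l,
                  forall lam : R, 0 <= lam <= l -> optimal m (lam *: x),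
                  boundary (feasible m) (l *: x)
                & saturates_depth m (l *: x)],
            forall (d : measure_display) (Omega : measurableType d)
              (P : probability Omega R) (S : Omega -> R),
              measurable_fun setT S -> (forall omega, 0 <= S omega) ->
              full_support P S ->
              weak_arbitrage m P S (impl_w x) (impl_c m x)
          & forall (d : measure_display) (Omega : measurableType d)
              (P : probability Omega R) (S : Omega -> R),
              measurable_fun setT S -> (forall omega, 0 <= S omega) ->
              (0 < P [set omega | (0 < Pi_tilde m x (S omega))%R])%E ->
              weak_arbitrage m P S (impl_w x) (impl_c m x)]
    & [/\ arbitrage_free m <->
            (forall y, optimal m y -> forall s : R, 0 <= s -> Pi_tilde m y s = 0),
          arbitrage_free m ->
            optimal m 0 /\
            (forall y, optimal m y ->
               [/\ impl_w y = 0, impl_c m y = 0 /\ alpha y = 0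
                 & forall i : 'I_N, call_bid m i < call_ask m i ->
                     q_ask y i = 0 /\ q_bid y i = 0])
        & arbitrage_free m -> (forall i : 'I_N, call_bid m i < call_ask m i) ->
            forall y, optimal m y <-> y = 0]].
Proof.
have xf := hx.1; have xle0 := optimal_le0 hx.
have afP := arbitrage_freeP hx.
have trivial0 y : optimal m y -> (forall s, 0 <= s -> Pi_tilde m y s = 0) ->
    pi0_tilde m y = 0.
  by move=> yo yPi; apply/le_anti; rewrite optimal_le0// (pi0_tilde_ge0 yo.1).
have caseP : pi0_tilde m x < 0 \/ pi0_tilde m x = 0.
  by move: xle0; rewrite le_eqVlt => /predU1P[]; [right|left].
have nontrivial y : ~ (forall s, 0 <= s -> Pi_tilde m y s = 0) <->
    exists2 s, 0 <= s & Pi_tilde m y s <> 0.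
  split=> [yN|[s s0 ys] yPi]; last exact: ys (yPi s s0).
  apply: contrapT => h; apply: yN => s s0; apply: contrapT => ys.
  by apply: h; exists s.
split.
- split.
  + have [x0|x0] := caseP; first by constructor 1.
    have [xPi|/nontrivial xPi] :=
      pselect (forall s, 0 <= s -> Pi_tilde m x s = 0); first by constructor 3.
    by constructor 2.
  + by move=> [x0 [x1 _]]; rewrite x1 ltxx in x0.
  + by move=> [x0 /(trivial0 x hx) x1]; rewrite x1 ltxx in x0.
  + by move=> [[_ /nontrivial]].
- split.
  + have [x0|x0] := caseP; first by constructor 1.
    have [af|naf] := pselect (arbitrage_free m); first by constructor 3.
    (* An arbitrage yields some optimum with nonzero payoff, possibly other than [x]. *)
    constructor 2; split=> //; apply: contrapT => h; apply: naf; apply/afP.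
    move=> y yo; apply: contrapT => /nontrivial yPi.
    by apply: h; exists y.
  + by move=> [x0 [x1 _]]; rewrite x1 ltxx in x0.
  + by move=> [x0 /afP/(_ x hx)/(trivial0 x hx) x1]; rewrite x1 ltxx in x0.
  + by move=> [[_ [y yo /nontrivial yPi]] /afP/(_ y yo)].
- by move=> x0; split; [exact: optimal_saturates|exact: impl_strong_arbitrage].
- move=> [x0 xPi].
  (* At value 0 the net payoff of the implementation is [Pi_tilde] itself. *)
  have posE T (S : T -> R) : (forall o, 0 <= S o) ->
      [set o | 0 < Pi_tilde m x (S o)] =
      [set o | 0 < terminal_payoff m (impl_w x) (S o) + impl_c m x * growth m].
    move=> S0; apply/seteqP.
    by split=> o /=; rewrite impl_payoffE// x0 mul0r subr0.
  have neg0 d (Omega : measurableType d) (P : probability Omega R)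
      (S : Omega -> R) : (forall o, 0 <= S o) ->
      P (S @^-1` `]-oo, 0[%classic) = 0%E.
    move=> S0; rewrite (_ : _ @^-1` _ = set0) ?measure0//.
    by apply/seteqP; split=> o //=; rewrite in_itv/= ltNge S0.
  split.
  + move=> xE; case: xPi => s _; apply.
    by rewrite xE -(scale0r x) Pi_tildeZ mul0r.
  + exact: optimal_segment.
  + move=> d Omega P S mS S0 PS; apply: impl_weak_arbitrage => //.
      exact: neg0.
    case: xPi => s s0 xs.
    apply: (full_support_gt0 (f := fun s => terminal_payoff m (impl_w x) s +
      impl_c m x * growth m) (s0 := s)) => //.
      exact: continuous_net_payoff.
    rewrite impl_payoffE// x0 mul0r subr0 lt_def; apply/andP; split.
      exact/eqP.
    by have /feasibleP[-> //] := xf.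
  + move=> d Omega P S mS S0 PS; apply: impl_weak_arbitrage => //.
      exact: neg0.
    by rewrite -posE.
- have optimal0 : arbitrage_free m -> optimal m 0.
    move=> /afP/(_ x hx)/(trivial0 x hx) x0.
    apply/(optimal_eq0 _ hx x0); rewrite -(scale0r x) pi0_tildeZ mul0r.
    by split=> //; apply: feasibleZ_le1; rewrite ?lexx ?ler01.
  split=> //.
  + move=> af; split=> [|y yo]; first exact: optimal0.
    exact: trivial_optimal yo (afP.1 af y yo).
  + move=> af spread y; split=> [yo|->]; last exact: optimal0.
    have yPi := afP.1 af y yo.
    have [w0 [_ a0] q0] := trivial_optimal yo yPi.
    (* The net positions give the underlying; the two sides of each quote vanish separately thanks
       to the spread. *)
    have u0 : q_und y = 0 by rewrite -impl_w_ord0 w0 mxE.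
    have qa0 : y.1.1.1 = 0.
      by apply/rowP => i; rewrite mxE; exact: (q0 i (spread i)).1.
    have qb0 : y.1.1.2 = 0.
      by apply/rowP => i; rewrite mxE; exact: (q0 i (spread i)).2.
    move: u0 a0 qa0 qb0; rewrite /q_und /alpha.
    by case: y {yo yPi w0 q0} => [[[a b] u] v] /= -> -> -> ->.
Qed.
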